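(* Let $X$ be a real Banach space and let $(x_k)$ be a bounded sequence in $X$. Then $$\widehat{\operatorname{d}}(\operatorname{clust}_{X^{**}}(x_k),X)\le \operatorname{ca}(x_k)\qquad\text{and}\qquad \delta(x_k)\le \operatorname{ca}(x_k).$$ In particular, for $C\ge 0$, if $X$ has the $C$-Schur property, then $X$ is $C$-weakly sequentially complete.
   Context: All Banach spaces are real, and a Banach space $X$ is regarded as a subspace of its bidual $X^{**}$ via the canonical embedding. For a bounded sequence $(x_k)$ in $X$: - $\operatorname{clust}_{X^{**}}(x_k)$ is the set of all weak* cluster points of $(x_k)$ in $X^{**}$; - $\delta(x_k)$ is the (norm) diameter of $\operatorname{clust}_{X^{**}}(x_k)$; - $\operatorname{ca}(x_k)=\inf_{n\in\mathbb N}\operatorname{diam}\{x_k: k\ge n\}$. For nonempty subsets $A,B$ of a Banach space, $\operatorname{d}(A,B)=\inf\{\|a-b\|: a\in A, b\in B\}$, $\operatorname{d}(a,B)=\operatorname{d}(\{a\},B)$, and $\widehat{\operatorname{d}}(A,B)=\sup\{\operatorname{d}(a,B): a\in A\}$ (distances between subsets of $X^{**}$ are taken in the norm of $X^{**}$). For $C\ge 0$, $X$ has the $C$-Schur property if $\operatorname{ca}(x_k)\le C\,\delta(x_k)$ for each bounded sequence $(x_k)$ in $X$; $X$ is $C$-weakly sequentially complete if $\widehat{\operatorname{d}}(\operatorname{clust}_{X^{**}}(x_k),X)\le C\,\delta(x_k)$ for each bounded sequence $(x_k)$ in $X$. *)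

(* Defs.v *)
From HB Require Import structures.
From mathcomp Require Import all_boot all_order all_algebra.
From mathcomp Require Import all_classical all_reals all_analysis.

Set Implicit Arguments.
Unset Strict Implicit.
Unset Printing Implicit Defensive.

Import Order.TTheory GRing.Theory Num.Def Num.Theory.
Import numFieldTopology.Exports numFieldNormedType.Exports.

Local Open Scope classical_set_scope.
Local Open Scope ring_scope.

Section ContinuousDual.
Variables (R : realType) (V : normedModType R).

Definition cont_linear : {pred V -> R^o} :=
  [pred f : V -> R^o | `[< linear f /\ continuous f >]].

Lemma cont_linearP (f : V -> R^o) :
  reflect (linear f /\ continuous f) (f \in cont_linear).
Proof. exact: asboolP. Qed.

Record dual : Type := Dual {
  dual_val :> V -> R^o ;
  _ : dual_val \in cont_linear }.

HB.instance Definition _ := [isSub for dual_val].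
HB.instance Definition _ := [Choice of dual by <:].

Lemma cont_linear_submod_closed : submod_closed cont_linear.
Proof.
split=> [|a f g].
  apply/cont_linearP; split; last by move=> x; exact: cvg_cst.
  by move=> b x y; rewrite /= scaler0 addr0.
move=> /cont_linearP[lf cf] /cont_linearP[lg cg]; apply/cont_linearP; split.
  move=> b x y.
  rewrite -[LHS]/(a *: f (b *: x + y) + g (b *: x + y)) lf lg.
  rewrite -[RHS]/(b *: (a *: f x + g x) + (a *: f y + g y)).
  by rewrite !scalerDr !scalerA (mulrC a b) addrACA.
by move=> x; apply: cvgD; [apply: cvgZr; exact: cf|exact: cg].
Qed.

HB.instance Definition _ := GRing.isSubmodClosed.Build R (V -> R^o) cont_linear
  cont_linear_submod_closed.
HB.instance Definition _ := [SubChoice_isSubLmodule of dual by <:].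

Lemma dual_linear (f : dual) : linear (f : V -> R^o).
Proof. by case: f => f /= /cont_linearP[]. Qed.

HB.instance Definition _ (f : dual) :=
  GRing.isLinear.Build R V R^o _ (f : V -> R^o) (@dual_linear f).

Lemma dual_continuous (f : dual) : continuous (f : V -> R^o).
Proof. by case: f => f /= /cont_linearP[]. Qed.

Definition dual_norm (f : dual) : R :=
  sup [set `|f x| | x in [set x : V | `|x| <= 1]].

Lemma dual_norm_has_sup (f : dual) :
  has_sup [set `|f x| | x in [set x : V | `|x| <= 1]].
Proof.
split; first by exists `|f 0|, 0 => //=; rewrite normr0.
have /bounded_funP/(_ 1)[M fM] : bounded_near (f : V -> R^o) (nbhs (0 : V)).
  by apply/linear_bounded_continuous; exact: dual_continuous.
by exists M => _ [x /= x1 <-]; exact: fM.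
Qed.

Lemma dual_norm_ub (f : dual) (x : V) : `|x| <= 1 -> `|f x| <= dual_norm f.
Proof.
move=> x1; apply: sup_ubound; first by case: (dual_norm_has_sup f).
by exists x.
Qed.

Lemma dual_norm_le (f : dual) (M : R) :
  (forall x, `|x| <= 1 -> `|f x| <= M) -> dual_norm f <= M.
Proof.
move=> fM; apply: ge_sup; first by case: (dual_norm_has_sup f).
by move=> _ [x /= x1 <-]; exact: fM.
Qed.

Lemma dual_norm_ge0 (f : dual) : 0 <= dual_norm f.
Proof. by rewrite (le_trans _ (@dual_norm_ub f 0 _))// normr0. Qed.

Lemma dual_norm_bound (f : dual) (x : V) : `|f x| <= dual_norm f * `|x|.
Proof.
have [->|x0] := eqVneq x 0; first by rewrite linear0 !normr0 mulr0.
have nx0 : 0 < `|x| by rewrite normr_gt0.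
have : `|f (`|x|^-1 *: x)| <= dual_norm f.
  by apply: dual_norm_ub; rewrite normrZ normfV normr_id mulVf// gt_eqF.
by rewrite linearZ/= normrZ normfV normr_id ler_pdivrMl// mulrC.
Qed.

Lemma ler_dual_normD (f g : dual) : dual_norm (f + g) <= dual_norm f + dual_norm g.
Proof.
apply: dual_norm_le => x x1.
by rewrite (le_trans (ler_normD _ _))// lerD// dual_norm_ub.
Qed.

Lemma ler_dual_normZ (a : R) (f : dual) : dual_norm (a *: f) <= `|a| * dual_norm f.
Proof.
apply: dual_norm_le => x x1.
have -> : (a *: f) x = a * f x by [].
by rewrite normrM ler_wpM2l// dual_norm_ub.
Qed.

Lemma dual_normZ (a : R) (f : dual) : dual_norm (a *: f) = `|a| * dual_norm f.
Proof.
have [->|a0] := eqVneq a 0.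
  apply/le_anti; rewrite ler_dual_normZ normr0 mul0r /=.
  exact: dual_norm_ge0.
apply/le_anti; rewrite ler_dual_normZ/= -ler_pdivlMl ?normr_gt0//.
have {1}-> : f = a^-1 *: (a *: f) by rewrite scalerA mulVf// scale1r.
by rewrite -normfV; exact: ler_dual_normZ.
Qed.

Lemma dual_norm0_eq0 (f : dual) : dual_norm f = 0 -> f = 0.
Proof.
move=> f0; apply: val_inj; apply/funext => x /=.
by apply/normr0_eq0/le_anti; rewrite normr_ge0 (le_trans (dual_norm_bound f x))// f0 mul0r.
Qed.

HB.instance Definition _ := Lmodule_isNormed.Build R dual
  ler_dual_normD dual_normZ dual_norm0_eq0.

(* The coarsest topology on [dual] making every evaluation [f |-> f v]
   continuous; as a type it is convertible to [dual]. *)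
Definition weak_star : Type :=
  initial_topology (fun f : dual => (f : {ptws V -> R})).

HB.instance Definition _ := Topological.on weak_star.

End ContinuousDual.

Section Bidual.
Variables (R : realType) (X : normedModType R).

Definition bidual : normedModType R := dual (dual X).

Lemma eval_cont_linear (x : X) :
  (fun f : dual X => f x : R^o) \in @cont_linear R (dual X).
Proof.
apply/cont_linearP.
have lx : linear (fun f : dual X => f x : R^o) by [].
split => //.
pose e : {linear dual X -> R^o} :=
  HB.pack (fun f : dual X => f x : R^o) (GRing.isLinear.Build R _ _ _ _ lx).
apply: (@bounded_linear_continuous _ _ _ e).
apply/linear_boundedP; exists `|x|; split; first exact: normr_real.
move=> r xr f; rewrite (le_trans (dual_norm_bound f x))// mulrC.
by rewrite ler_wpM2r ?dual_norm_ge0// ltW.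
Qed.

Definition to_bidual (x : X) : bidual := Dual (eval_cont_linear x).

End Bidual.

Section SetDistances.
Variables (R : realType) (V : normedModType R).
Implicit Types A B : set V.
Local Open Scope ereal_scope.

(* Suprema and infima are taken in \bar R, so that no finiteness is built in;
   diam and dhat are only meaningful for A != set0 (they return -oo there). *)
Definition diam A : \bar R :=
  ereal_sup [set `|a - b|%:E | a in A & b in A].

Definition dist A B : \bar R :=
  ereal_inf [set `|a - b|%:E | a in A & b in B].

Definition dhat A B : \bar R := ereal_sup [set dist [set a] B | a in A].

End SetDistances.

Section SequenceModuli.
Variables (R : realType) (X : normedModType R).
Implicit Types x : nat -> X.
Local Open Scope ereal_scope.

Definition clust x : set (bidual X) :=
  cluster ((fun k => to_bidual (x k) : weak_star (dual X)) @ \oo).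

Definition delta x : \bar R := diam (clust x).

Definition ca x : \bar R :=
  ereal_inf [set diam [set x k | k in [set k | (n <= k)%N]] | n in [set: nat]].

End SequenceModuli.

Definition Schur_property (R : realType) (C : R) (X : normedModType R) : Prop :=
  forall x : nat -> X, bounded_fun x -> (ca x <= C%:E * delta x)%E.

Definition weakly_seq_complete (R : realType) (C : R) (X : normedModType R) : Prop :=
  forall x : nat -> X, bounded_fun x ->
    (dhat (clust x) (range (@to_bidual R X)) <= C%:E * delta x)%E.

(* Main.v *)
(* A closed ball of the bidual is weak* closed, so if a tail of (x_k) lies within
   distance D of c, then so does every weak* cluster point of (x_k).  Let D be the
   diameter of the tail {x_k : k >= n}.  Taking c = x_m with m >= n bounds by D
   the distance from a cluster point to each x_m; taking then c to be a cluster
   point bounds by D the distance between two cluster points. *)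

Require Import Defs.
From mathcomp Require Import all_boot all_order all_algebra.
From mathcomp Require Import all_classical all_reals all_analysis.

Set Implicit Arguments.
Unset Strict Implicit.

Import Order.TTheory GRing.Theory Num.Theory.
Import numFieldTopology.Exports numFieldNormedType.Exports.

Local Open Scope classical_set_scope.
Local Open Scope ring_scope.

(** Evaluation factors through the pointwise topology as a coordinate projection. *)
Lemma weak_star_eval_continuous (R : realType) (V : normedModType R) (v : V) :
  continuous (fun f : weak_star V => (f : dual V) v : R).
Proof.
move=> f; apply: (@continuous_comp (weak_star V) {ptws V -> R} R
  (fun f : dual V => (f : {ptws V -> R})) (fun g => g v)).
  exact: initial_continuous.
exact: (@proj_continuous V (fun=> R) v).
Qed.

(** The functionals within [e] of [a] at [f] form a weak* neighbourhood of [a], which must meet the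
    tail from [n] on. *)
Lemma clust_eval_approx (R : realType) (X : normedModType R) (x : nat -> X)
    (a : bidual X) (f : dual X) (n : nat) (e : R) :
  clust x a -> 0 < e -> exists2 k, (n <= k)%N & `|a f - f (x k)| < e.
Proof.
move=> xa e0.
have tailA : ((fun k => to_bidual (x k) : weak_star (dual X)) @ \oo)
    [set to_bidual (x k) | k in [set k | (n <= k)%N]].
  by exists n => // k /= nk; exists k.
have nbhsB : nbhs (a : weak_star (dual X))
    [set g : weak_star (dual X) | `|a f - (g : bidual X) f| < e].
  have /cvgrPdist_lt/(_ e e0) := @weak_star_eval_continuous R (dual X) f a.
  exact.
by have [_ [[k nk <-] /= ake]] := xa _ _ tailA nbhsB; exists k.
Qed.

(** The norm is tested on one [f] of the unit ball at a time. The index [k] depends on [f] and [e],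
    but the bound [D] does not. *)
Lemma clust_dist_le (R : realType) (X : normedModType R) (x : nat -> X)
    (a c : bidual X) (n : nat) (D : R) :
  clust x a -> (forall k, (n <= k)%N -> `|to_bidual (x k) - c| <= D) ->
  `|a - c| <= D.
Proof.
move=> xa xcD; apply: dual_norm_le => f f1.
apply/ler_addgt0Pl => e e0.
have [k nk ake] := clust_eval_approx f n xa e0.
have -> : (a - c) f = (a f - f (x k)) + (to_bidual (x k) - c) f.
  by transitivity ((a f - f (x k)) + (f (x k) - c f)) => //; rewrite addrA subrK.
rewrite (le_trans (ler_normD _ _))// lerD//; first exact: ltW.
by rewrite (le_trans _ (xcD k nk))//; exact: (dual_norm_ub (to_bidual (x k) - c)).
Qed.

(** Carries tail diameters, measured in [X], over to the bidual norm. *)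
Lemma to_bidual_contraction (R : realType) (X : normedModType R) (u v : X) :
  `|to_bidual u - to_bidual v| <= `|u - v|.
Proof.
apply: dual_norm_le => f f1.
rewrite -[(to_bidual u - to_bidual v) f]/(f u - f v) -linearB.
by rewrite (le_trans (dual_norm_bound f _))// ler_piMl.
Qed.

Local Open Scope ereal_scope.

Lemma diam_le (R : realType) (V : normedModType R) (A : set V) (D : \bar R) :
  (forall u v, A u -> A v -> `|u - v|%:E <= D) -> diam A <= D.
Proof. by move=> AD; apply: ge_ereal_sup => _ [u Au [v Av <-]]; exact: AD. Qed.

Lemma diam_ub (R : realType) (V : normedModType R) (A : set V) (u v : V) :
  A u -> A v -> `|u - v|%:E <= diam A.
Proof. by move=> Au Av; apply: ereal_sup_ubound; exists u => //; exists v. Qed.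

Section TailDiameter.
Variables (R : realType) (X : normedModType R) (x : nat -> X) (n : nat).

Let tail := [set x k | k in [set k | (n <= k)%N]].

Lemma clust_to_tail (a : bidual X) (m : nat) :
  clust x a -> (n <= m)%N -> `|a - to_bidual (x m)|%:E <= diam tail.
Proof.
move=> xa nm.
have tailD k l : (n <= k)%N -> (n <= l)%N -> `|x k - x l|%:E <= diam tail.
  by move=> nk nl; apply: diam_ub; [exists k|exists l].
(* The value [-oo] is excluded because the tail contains [x n]. *)
have := tailD; case: (diam tail) => [D|_|/(_ n n)]; last 2 first.
- by rewrite leey.
- by move=> /(_ (leqnn n) (leqnn n)); rewrite leeNy_eq.
move=> xD; rewrite lee_fin; apply: (clust_dist_le (n := n) xa) => k nk.
by rewrite (le_trans (to_bidual_contraction _ _))// -lee_fin xD.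
Qed.

Lemma clust_to_clust (a b : bidual X) :
  clust x a -> clust x b -> `|a - b|%:E <= diam tail.
Proof.
move=> xa xb.
(* The tail lies in the ball of radius [diam tail] about [b], so [b] can serve as the centre in
   [clust_dist_le]. *)
have := fun m => @clust_to_tail b m xb; case: (diam tail) => [D|_|/(_ n)].
- move=> bD; rewrite lee_fin; apply: (clust_dist_le (n := n) xa) => k nk.
  by rewrite distrC -lee_fin bD.
- by rewrite leey.
- by move=> /(_ (leqnn n)); rewrite leeNy_eq.
Qed.

End TailDiameter.

Lemma dhat_clust_le_ca (R : realType) (X : normedModType R) (x : nat -> X) :
  dhat (clust x) (range (@to_bidual R X)) <= ca x.
Proof.
apply: ge_ereal_sup => _ [a xa <-]; apply: le_ereal_inf_tmp => _ [n _ <-].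
(* The first term [x n] of the tail serves as the point of [X] near [a]. *)
apply: le_trans (clust_to_tail xa (leqnn n)).
apply: ereal_inf_lbound; exists a => //.
by exists (to_bidual (x n)) => //; exists (x n).
Qed.

Lemma delta_le_ca (R : realType) (X : normedModType R) (x : nat -> X) :
  delta x <= ca x.
Proof.
apply: diam_le => a b xa xb; apply: le_ereal_inf_tmp => _ [n _ <-].
exact: clust_to_clust.
Qed.

Local Close Scope ereal_scope.

Unset Implicit Arguments.
Set Strict Implicit.

Theorem proposition1p1 (R : realType) (X : completeNormedModType R) :
  (forall x : nat -> X, bounded_fun x ->
     (dhat (clust x) (range (@to_bidual R X)) <= ca x)%E /\
     (delta x <= ca x)%E) /\
  (forall C : R, 0 <= C ->
     Schur_property C X -> weakly_seq_complete C X).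
Proof.
split=> [x _|C _ schurX x bx].
  by split; [exact: dhat_clust_le_ca|exact: delta_le_ca].
(* The modulus [ca x] lies between the two sides of the required inequality. *)
exact: le_trans (dhat_clust_le_ca _) (schurX x bx).
Qed.
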